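(* Let $N,K\ge 1$ and let $\mathcal{R}\subset\mathbb{C}[\mathcal{S}_N]$ be a minimal right ideal with $\mathcal{R}\not\subseteq\mathcal{J}_0$. Then the set of (primitive) generating idempotents of $\mathcal{R}$ contains one and only one idempotent $f$ with $\overline{f}^{\ast}=f$. Moreover, $f$ can be formed from an arbitrary generating idempotent $e$ of $\mathcal{R}$ by $$f=\mu\, e\cdot\overline{e}^{\ast}$$ with some $\mu\in\mathbb{R}$.
   Context: $\mathcal{S}_N$ is the symmetric group of permutations of $\{1,\dots,N\}$ with product $(p\circ q)(i)=p(q(i))$, and $\mathbb{C}[\mathcal{S}_N]$ is its complex group ring. For $a=\sum_p a_p\,p$ put $\overline{a}:=\sum_p\overline{a_p}\,p$ and $a^{\ast}:=\sum_p a_p\,p^{-1}$; thus $\overline{a}^{\ast}=\sum_p\overline{a_p}\,p^{-1}$. $\mathcal{H}$ is the complex Hilbert space with orthonormal basis $\{|\sigma\rangle\}$ indexed by all functions $\sigma:\{1,\dots,N\}\to\{1,\dots,K\}$ (so $\dim\mathcal{H}=K^N$). A permutation acts by $p|\sigma\rangle:=|\sigma\circ p^{-1}\rangle$, and $\mathbb{C}[\mathcal{S}_N]$ acts on $\mathcal{H}$ by linear extension. $\mathcal{J}_0:=\{a\in\mathbb{C}[\mathcal{S}_N] : au=0\ \text{for all } u\in\mathcal{H}\}$. A generating idempotent of a right ideal $\mathcal{R}$ is an idempotent $e$ with $\mathcal{R}=e\cdot\mathbb{C}[\mathcal{S}_N]$; generating idempotents of minimal right ideals are primitive. *)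

(* Defs.v *)
From HB Require Import structures.
From mathcomp Require Import all_boot all_order all_fingroup all_algebra.
From mathcomp Require Import boolp classical_sets reals.
From mathcomp.real_closed Require Export complex.
Set Implicit Arguments.
Unset Strict Implicit.
Unset Printing Implicit Defensive.
Import Order.TTheory GRing.Theory Num.Theory.
Local Open Scope classical_set_scope.
Local Open Scope ring_scope.
Local Open Scope complex_scope.

(* The product [s * t] of MathComp permutations applies [s] first, hence the
   swap. *)
Definition perm_comp (N : nat) (p q : 'S_N) : 'S_N := (q * p)%g.

Lemma perm_compE (N : nat) (p q : 'S_N) (i : 'I_N) : perm_comp p q i = p (q i).
Proof. by rewrite permM. Qed.

(* An alias of the type of coefficient families [a : p |-> a_p], so that the
   product is the convolution below and not the pointwise product of
   [{ffun _ -> _}]. *)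
Definition group_alg (F : comNzRingType) (N : nat) : Type :=
  {ffun 'S_N -> F^o}.

Section GroupAlgebra.
Variables (F : comNzRingType) (N : nat).
Local Notation A := (group_alg F N).
Implicit Types a b c : A.

HB.instance Definition _ := Choice.copy A {ffun 'S_N -> F^o}.
HB.instance Definition _ := GRing.Lmodule.copy A {ffun 'S_N -> F^o}.

Definition ga_coef (a : A) (p : 'S_N) : F := (a : {ffun 'S_N -> F^o}) p.

Definition ga_of_fun (f : 'S_N -> F) : A := [ffun p => f p].

Lemma ga_of_funE f p : ga_coef (ga_of_fun f) p = f p.
Proof. by rewrite /ga_coef ffunE. Qed.

Lemma gaP a b : ga_coef a =1 ga_coef b <-> a = b.
Proof. by split=> [e|-> //]; apply/ffunP. Qed.

Lemma ga_coef0 p : ga_coef (0 : A) p = 0.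
Proof. by rewrite /ga_coef ffunE. Qed.

Lemma ga_coefD a b p : ga_coef (a + b) p = ga_coef a p + ga_coef b p.
Proof. by rewrite /ga_coef ffunE. Qed.

Lemma ga_coefZ (k : F) a p : ga_coef (k *: a) p = k * ga_coef a p.
Proof. by rewrite /ga_coef ffunE. Qed.

Definition ga_perm (p : 'S_N) : A := ga_of_fun (fun q => (q == p)%:R).

Definition ga_one : A := ga_perm 1%g.

Definition ga_mul a b : A :=
  ga_of_fun (fun r => \sum_(p : 'S_N) \sum_(q | perm_comp p q == r)
                        ga_coef a p * ga_coef b q).

Lemma ga_coefM a b r :
  ga_coef (ga_mul a b) r = \sum_p ga_coef a p * ga_coef b (r * p^-1)%g.
Proof.
rewrite ga_of_funE; apply: eq_bigr => p _.
apply: big_pred1 => q /=.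
by rewrite /perm_comp -[RHS](inj_eq (mulIg p)) mulgKV.
Qed.

Lemma ga_mulA : associative ga_mul.
Proof.
move=> a b c; apply/gaP => r; rewrite !ga_coefM.
under eq_bigr do rewrite ga_coefM mulr_sumr.
under [RHS]eq_bigr do rewrite ga_coefM mulr_suml.
rewrite [RHS]exchange_big /=; apply: eq_bigr => p _.
rewrite [RHS](reindex_inj (mulIg p)) /=; apply: eq_bigr => q _.
by rewrite mulgK invMg !mulgA mulrA.
Qed.

Lemma ga_mul1l : left_id ga_one ga_mul.
Proof.
move=> a; apply/gaP => r; rewrite ga_coefM (bigD1 1%g) //= big1 ?addr0.
  by rewrite ga_of_funE eqxx mul1r invg1 mulg1.
by move=> p /negbTE np; rewrite ga_of_funE np mul0r.
Qed.

Lemma ga_mul1r : right_id ga_one ga_mul.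
Proof.
move=> a; apply/gaP => r; rewrite ga_coefM (bigD1 r) //= big1 ?addr0.
  by rewrite ga_of_funE mulgV eqxx mulr1.
by move=> p np; rewrite ga_of_funE -eq_mulgV1 eq_sym (negbTE np) mulr0.
Qed.

Lemma ga_mulDl : left_distributive ga_mul +%R.
Proof.
move=> a b c; apply/gaP => r; rewrite ga_coefD !ga_coefM -big_split.
by apply: eq_bigr => p _; rewrite ga_coefD mulrDl.
Qed.

Lemma ga_mulDr : right_distributive ga_mul +%R.
Proof.
move=> a b c; apply/gaP => r; rewrite ga_coefD !ga_coefM -big_split.
by apply: eq_bigr => p _; rewrite ga_coefD mulrDr.
Qed.

Lemma ga_one_neq0 : ga_one != 0.
Proof.
apply/eqP => /gaP /(_ 1%g) /eqP.
by rewrite ga_of_funE ga_coef0 eqxx oner_eq0.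
Qed.

HB.instance Definition _ := GRing.Zmodule_isNzRing.Build A
  ga_mulA ga_mul1l ga_mul1r ga_mulDl ga_mulDr ga_one_neq0.

Lemma ga_scaleAl (k : F) a b : k *: (a * b) = (k *: a) * b.
Proof.
apply/gaP => r; rewrite ga_coefZ !ga_coefM mulr_sumr.
by apply: eq_bigr => p _; rewrite ga_coefZ mulrA.
Qed.

HB.instance Definition _ := GRing.Lmodule_isLalgebra.Build F A ga_scaleAl.

Lemma ga_scaleAr (k : F) a b : k *: (a * b) = a * (k *: b).
Proof.
apply/gaP => r; rewrite ga_coefZ !ga_coefM mulr_sumr.
by apply: eq_bigr => p _; rewrite ga_coefZ mulrCA.
Qed.

HB.instance Definition _ := GRing.Lalgebra_isAlgebra.Build F A ga_scaleAr.

Lemma ga_permM p q : ga_perm p * ga_perm q = ga_perm (perm_comp p q).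
Proof.
apply/gaP => r; rewrite ga_coefM (bigD1 p) //= big1 => [|s /negbTE ns];
  rewrite !ga_of_funE ?ns ?mul0r // eqxx mul1r addr0.
by rewrite /perm_comp -(inj_eq (mulIg p)) mulgKV.
Qed.

Definition ga_star a : A := ga_of_fun (fun p => ga_coef a p^-1%g).

End GroupAlgebra.

Definition ga_conj (R : realType) (N : nat) (a : group_alg R[i] N) :
  group_alg R[i] N := ga_of_fun (fun p => (ga_coef a p)^*%C).

(* [u] stands for the vector whose coordinate along the basis vector
   [ket s] is [u s]. *)
Definition states (F : comNzRingType) (N K : nat) : Type :=
  {ffun {ffun 'I_N -> 'I_K} -> F^o}.

Section Action.
Variables (F : comNzRingType) (N K : nat).

HB.instance Definition _ := Choice.copy (states F N K)
  {ffun {ffun 'I_N -> 'I_K} -> F^o}.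
HB.instance Definition _ := GRing.Lmodule.copy (states F N K)
  {ffun {ffun 'I_N -> 'I_K} -> F^o}.

Definition st_coef (u : states F N K) (s : {ffun 'I_N -> 'I_K}) : F :=
  (u : {ffun {ffun 'I_N -> 'I_K} -> F^o}) s.

Definition ket (s : {ffun 'I_N -> 'I_K}) : states F N K :=
  [ffun t => (t == s)%:R].

Definition perm_ket (p : 'S_N) (s : {ffun 'I_N -> 'I_K}) : states F N K :=
  ket [ffun i => s (p^-1%g i)].

Definition ga_act (a : group_alg F N) (u : states F N K) : states F N K :=
  \sum_(p : 'S_N) \sum_(s : {ffun 'I_N -> 'I_K})
    (ga_coef a p * st_coef u s) *: perm_ket p s.

Definition J0 : set (group_alg F N) :=
  [set a | forall u : states F N K, ga_act a u = 0].

End Action.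

Arguments J0 : clear implicits.

Section RightIdeals.
Variable A : nzRingType.

Definition right_ideal (I : set A) : Prop :=
  [/\ I 0, forall x y, I x -> I y -> I (x + y)
    & forall x a, I x -> I (x * a)].

Definition minimal_right_ideal (I : set A) : Prop :=
  [/\ right_ideal I, I <> [set 0]
    & forall J, right_ideal J -> J `<=` I -> J = [set 0] \/ J = I].

Definition idempotent_elt (e : A) : Prop := e * e = e.

Definition generating_idempotents (I : set A) : set A :=
  [set e | idempotent_elt e /\ I = range (fun a => e * a)].

Definition primitive_idempotent (e : A) : Prop :=
  [/\ idempotent_elt e, e <> 0
    & forall e1 e2, idempotent_elt e1 -> idempotent_elt e2 ->
        e1 * e2 = 0 -> e2 * e1 = 0 -> e = e1 + e2 -> e1 = 0 \/ e2 = 0].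

End RightIdeals.

(* Main.v *)
Require Import Defs.
From HB Require Import structures.
From mathcomp Require Import all_boot all_order all_fingroup all_algebra.
From mathcomp Require Import falgebra.
From mathcomp Require Import boolp classical_sets reals.
Set Implicit Arguments.
Unset Strict Implicit.
Unset Printing Implicit Defensive.
Import Order.TTheory GRing.Theory Num.Theory.
Local Open Scope classical_set_scope.
Local Open Scope ring_scope.

(** Write [a^+] for the conjugate transpose [ga_star (ga_conj a)]. It is a
    conjugate-linear anti-automorphism of the group algebra, and it is proper:
    the coefficient of [a * a^+] at the identity is the sum of the [|a_p|^2],
    so [a * a^+ = 0] forces [a = 0]. Everything else is a general fact about a
    minimal right ideal [I] of a finite-dimensional algebra over an
    algebraically closed field with such an involution.

    Let [e] be a generating idempotent and [h = e * e^+], a self-adjoint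
    element of [I]. Properness, used twice, gives [h != 0] and
    [h * h = h * h^+ != 0]. Schur's lemma says that the corner [e A e] consists
    of the scalar multiples of [e] ([minimal_corner_scalar]), so
    [h * h = (e * e^+ * e) * e^+] is [k *: h] for some scalar [k]. This
    [k] is nonzero, and it is real because [h] is self-adjoint. Hence
    [k^-1 *: h] is a self-adjoint nonzero idempotent of [I], and by minimality
    it generates [I] ([proper_star_selfadjoint]). Two self-adjoint generators
    [f] and [g] coincide: [f * g = g] holds because [g] lies in [f A], and
    applying the involution to it gives [g * f = g], while [g * f = f].

    A generating idempotent exists by Brauer's argument, for which properness
    again supplies the element of nonzero square that is required. *)

(** * Minimal right ideals *)

Lemma minimal_right_ideal_eq (A : nzRingType) (I J : set A) (y : A) :
  minimal_right_ideal I -> right_ideal J -> J `<=` I -> J y -> y <> 0 -> J = I.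
Proof.
move=> [_ _ minI] idJ sJI Jy y0.
by case: (minI J idJ sJI) => // J0'; move: Jy; rewrite J0' => /y0.
Qed.

Lemma right_ideal_principal (A : nzRingType) (x : A) :
  right_ideal (range (fun a => x * a)).
Proof.
split=> [|_ _ [a _ <-] [b _ <-]|_ b [a _ <-]].
- by exists 0 => //; rewrite mulr0.
- by exists (a + b) => //; rewrite mulrDr.
- by exists (a * b) => //; rewrite mulrA.
Qed.

Lemma minimal_right_ideal_principal (A : nzRingType) (I : set A) (x : A) :
  minimal_right_ideal I -> I x -> x <> 0 -> range (fun a => x * a) = I.
Proof.
move=> minI Ix x0; have [[_ _ IM] _ _] := minI.
apply: (minimal_right_ideal_eq minI (right_ideal_principal x) _ _ x0).
- by move=> _ [a _ <-]; apply: IM.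
- by exists 1 => //; rewrite mulr1.
Qed.

Lemma minimal_right_ideal_idempotent (A : nzRingType) (I : set A) (e : A) :
  minimal_right_ideal I -> I e -> idempotent_elt e -> e <> 0 ->
  generating_idempotents I e.
Proof.
by move=> minI Ie ee e0; split=> //; rewrite (minimal_right_ideal_principal minI).
Qed.

Section GeneratingIdempotents.
Variables (A : nzRingType) (I : set A) (e : A).
Hypothesis genIe : generating_idempotents I e.

Lemma generating_idempotent_mem : I e.
Proof. by case: genIe => _ ->; exists 1 => //; rewrite mulr1. Qed.

Lemma generating_idempotent_mull (x : A) : I x -> e * x = x.
Proof. by case: genIe => ee -> [a _ <-]; rewrite mulrA ee. Qed.

Lemma generating_idempotent_neq0 : minimal_right_ideal I -> e <> 0.
Proof.
move=> [_ I0 _] e0; apply: I0; case: genIe => _ ->; rewrite e0.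
apply/seteqP; split=> [_ [a _ <-]|_ ->]; first by rewrite mul0r.
by exists 0 => //; rewrite mulr0.
Qed.

(** In a decomposition [e = e1 + e2] into orthogonal idempotents, a nonzero
    [e1] generates all of [I], so [e1 * e2 = e2]: orthogonality kills [e2]. *)
Lemma generating_idempotent_primitive :
  minimal_right_ideal I -> primitive_idempotent e.
Proof.
move=> minI; split; [by case: genIe | exact: generating_idempotent_neq0 |].
move=> e1 e2 ee1 ee2 e12 e21 de; have [[_ _ IM] _ _] := minI.
have Ie := generating_idempotent_mem.
have Ie1 : I e1 by rewrite -[e1]add0r -e21 -{2}ee1 addrC -mulrDl -de; apply: IM.
have Ie2 : I e2 by rewrite -[e2]addr0 -e12 -{1}ee2 addrC -mulrDl -de; apply: IM.
have [->|/eqP e10] := eqVneq e1 0; [by left | right].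
have [_ gen1] := minimal_right_ideal_idempotent minI Ie1 ee1 e10.
by move: Ie2; rewrite gen1 => -[a _ /= e2E]; rewrite -e12 -e2E mulrA ee1.
Qed.

End GeneratingIdempotents.

(** Brauer's argument: left multiplication by [y] maps [I] onto itself, since
    [y I] is a nonzero right ideal inside [I], and it is injective on [I],
    since its kernel is a right ideal that misses [y]. The preimage [e] of [y]
    satisfies [y * (e * e - e) = 0]. *)
Lemma minimal_right_ideal_has_idempotent (A : nzRingType) (I : set A) (y : A) :
  minimal_right_ideal I -> I y -> y * y <> 0 ->
  exists e, generating_idempotents I e.
Proof.
move=> minI Iy yy0; have [[I0 ID IM] _ _] := minI.
pose J := [set y * z | z in I].
have JI : J = I.
  apply: (minimal_right_ideal_eq minI _ _ _ yy0); last by exists y.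
  - split=> [|_ _ [a Ia <-] [b Ib <-]|_ b [a Ia <-]].
    + by exists 0 => //; rewrite mulr0.
    + by exists (a + b); [apply: ID | rewrite mulrDr].
    + by exists (a * b); [apply: IM | rewrite mulrA].
  - by move=> _ [z _ <-]; apply: IM.
have inj z : I z -> y * z = 0 -> z = 0.
  move=> Iz yz; apply/eqP; apply: contrapT => /negP/eqP z0.
  pose Ker := [set w | I w /\ y * w = 0].
  suff KerI : Ker = I by move: Iy; rewrite -KerI => -[_ /yy0].
  apply: (minimal_right_ideal_eq minI _ _ _ z0); last by [].
  - split=> [|a b [Ia ya] [Ib yb]|a b [Ia ya]].
    + by split=> //; rewrite mulr0.
    + by split; [apply: ID | rewrite mulrDr ya yb addr0].
    + by split; [apply: IM | rewrite mulrA ya mul0r].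
  - by move=> w [].
have [e Ie ye] : J y by rewrite JI.
exists e; apply: minimal_right_ideal_idempotent => //.
- apply/eqP; rewrite -subr_eq0; apply/eqP; apply: inj.
    by rewrite -mulrN1; apply: ID; apply: IM.
  by rewrite mulrBr mulrA ye ye subrr.
- by move=> e0; apply: yy0; rewrite -{1}ye e0 mulr0 mul0r.
Qed.

(** * Schur's lemma *)

Lemma falg_annihilating_poly (F : fieldType) (A : falgType F) (x : A) :
  exists2 p : {poly F}, p != 0 & horner_alg x p = 0.
Proof.
pose n := (\dim {:A}).+1.
pose X : n.-tuple A := [tuple x ^+ i | i < n].
have : ~~ free X.
  rewrite /free size_tuple neq_ltn; apply/orP; left.
  by rewrite ltnS dimvS ?subvf.
move=> /freeP/existsNP[k /not_implyP[kX /existsNP[i /eqP ki]]].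
exists (\poly_(j < n) k (inord j)).
  apply: contraNneq ki => /(congr1 (fun p : {poly F} => p`_i)).
  by rewrite coef_poly ltn_ord inord_val coef0 => ->.
rewrite poly_def raddf_sum /= -[RHS]kX; apply: eq_bigr => j _.
rewrite inord_val -mul_polyC rmorphM /= horner_algC rmorphXn /= horner_algX.
by rewrite mulr_algl (nth_map j) ?size_enum_ord // nth_ord_enum.
Qed.

Lemma right_idealZ (F : nzRingType) (A : algType F) (I : set A) (k : F) (v : A) :
  right_ideal I -> I v -> I (k *: v).
Proof. by move=> [_ _ IM] Iv; rewrite -mulr_algr; apply: IM. Qed.

(** Apply the linear factors of a polynomial annihilating [x] one after the
    other to a nonzero element of [I]: the last nonzero result is an
    eigenvector. *)
Lemma right_ideal_eigenvector (F : closedFieldType) (A : falgType F)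
    (I : set A) (x v : A) :
  right_ideal I -> I x -> I v -> v <> 0 ->
  exists r w, [/\ I w, w <> 0 & x * w = r *: w].
Proof.
move=> idI Ix Iv v0; have [_ ID IM] := idI.
have [p p0 px0] := falg_annihilating_poly x.
have [s ps] := closed_field_poly_normal p.
have : horner_alg x (\prod_(z <- s) ('X - z%:P)) * v = 0.
  apply/eqP; move: px0; rewrite ps -mul_polyC rmorphM /= horner_algC mulr_algl.
  by move/eqP; rewrite scaler_eq0 lead_coef_eq0 (negbTE p0) => /eqP->; rewrite mul0r.
elim: s v Iv v0 {p p0 px0 ps} => [|r s IHs] v Iv v0.
  by rewrite big_nil rmorph1 mul1r => /v0.
rewrite big_cons mulrC rmorphM /= rmorphB /= horner_algX horner_algC -mulrA.
rewrite mulrBl mulr_algl.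
have [/subr0_eq xv _|/eqP v'0] := eqVneq (x * v - r *: v) 0.
  by exists r, v.
apply: IHs v'0; rewrite -scaleNr.
by apply: ID; [apply: IM | apply: right_idealZ].
Qed.

(** Schur's lemma: left multiplication by [x = e * a * e] preserves [I] and has
    an eigenvector there. The eigenspace is a nonzero right ideal inside [I],
    so it is [I] and contains [e]. *)
Lemma minimal_corner_scalar (F : closedFieldType) (A : falgType F)
    (I : set A) (e a : A) :
  minimal_right_ideal I -> generating_idempotents I e ->
  exists k : F, e * a * e = k *: e.
Proof.
move=> minI genIe; have [idI _ _] := minI; have [I0 ID IM] := idI.
have Ie := generating_idempotent_mem genIe; have [ee _] := genIe.
have [k [w [Iw w0 xw]]] := right_ideal_eigenvector idI
  (IM _ e (IM _ a Ie)) Ie (generating_idempotent_neq0 genIe minI).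
exists k; pose J := [set z | I z /\ e * a * e * z = k *: z].
suff JI : J = I by move: Ie; rewrite -JI => -[_]; rewrite -!mulrA ee.
apply: (minimal_right_ideal_eq minI _ _ _ w0); last by [].
- split=> [|b c [Ib xb] [Ic xc]|b c [Ib xb]].
  + by split=> //; rewrite mulr0 scaler0.
  + by split; [apply: ID | rewrite mulrDr xb xc scalerDr].
  + by split; [apply: IM | rewrite mulrA xb scalerAl].
- by move=> z [].
Qed.

(** * Algebras with a proper involution *)

Definition proper_star (C : numClosedFieldType) (A : algType C)
    (star : A -> A) : Prop :=
  [/\ involutive star, {morph star : x y / x * y >-> y * x},
      forall k x, star (k *: x) = k^* *: star x
    & forall x, x * star x = 0 -> x = 0].

Section ProperStar.
Variables (C : numClosedFieldType) (A : falgType C) (star : A -> A).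
Hypothesis star_proper : proper_star star.
Variable I : set A.
Hypothesis minI : minimal_right_ideal I.

Lemma star_mul_selfadjoint (x : A) : star (x * star x) = x * star x.
Proof. by case: star_proper => starK starM _ _; rewrite starM starK. Qed.

Lemma star_mul_square_neq0 (x : A) :
  x <> 0 -> x * star x * (x * star x) <> 0.
Proof.
case: star_proper => _ _ _ star0 x0 hh; apply/x0/star0/star0.
by rewrite star_mul_selfadjoint.
Qed.

Lemma proper_star_has_idempotent : exists e, generating_idempotents I e.
Proof.
have [[I0 ID IM] nI0 _] := minI.
have [x Ix x0] : exists2 x, I x & x <> 0.
  apply: contrapT => noI; apply: nI0; apply/seteqP; split=> [x Ix|_ -> //].
  by apply: contrapT => x0; apply: noI; exists x.
by apply: (minimal_right_ideal_has_idempotent minI (IM _ (star x) Ix));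
   apply: star_mul_square_neq0.
Qed.

Lemma selfadjoint_generating_idempotent_unique (f g : A) :
  generating_idempotents I f -> star f = f ->
  generating_idempotents I g -> star g = g -> f = g.
Proof.
case: star_proper => _ starM _ _ genf sf geng sg.
have fg := generating_idempotent_mull genf (generating_idempotent_mem geng).
have gf := generating_idempotent_mull geng (generating_idempotent_mem genf).
by rewrite -gf -{1}sf -{1}sg -starM fg sg.
Qed.

(** With [h = e * star e] and [h * h = k *: h], the scalar [k] is nonzero by
    properness, and it is real because applying [star] to [h * h = k *: h]
    replaces [k] by its conjugate. *)
Lemma proper_star_selfadjoint (e : A) : generating_idempotents I e ->
  exists mu : C, [/\ mu \is Num.real,
    generating_idempotents I (mu *: (e * star e))
  & star (mu *: (e * star e)) = mu *: (e * star e)].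
Proof.
move=> genIe; have [idI _ _] := minI; have [_ _ IM] := idI.
have Ie := generating_idempotent_mem genIe.
have hh0 := star_mul_square_neq0 (generating_idempotent_neq0 genIe minI).
have sh := star_mul_selfadjoint e.
have [k ek] := minimal_corner_scalar (star e) minI genIe.
move: (IM _ (star e) Ie) hh0 sh; set h := e * star e => Ih hh0 sh.
have hh : h * h = k *: h by rewrite {1}/h {1}/h mulrA ek scalerAl.
have h0 : h != 0 by apply/eqP => h0; apply: hh0; rewrite h0 mul0r.
have k0 : k != 0 by apply/eqP => k0; apply: hh0; rewrite hh k0 scale0r.
have [_ starM starZ _] := star_proper.
have kR : k^* = k.
  apply/eqP; rewrite -subr_eq0 -[_ == 0]orbF -(negbTE h0) -scaler_eq0.
  by rewrite scalerBl -{1}sh -starZ -hh starM sh subrr.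
exists k^-1; split.
- by rewrite realV; apply/CrealP.
- apply: minimal_right_ideal_idempotent => //; first exact: right_idealZ.
  + by rewrite /idempotent_elt -scalerAl -scalerAr hh !scalerA mulfVK.
  + by apply/eqP; rewrite scaler_eq0 invr_eq0 negb_or k0.
- by rewrite starZ sh fmorphV /= kR.
Qed.

End ProperStar.

(** * The conjugate transpose of the group algebra *)

Local Open Scope complex_scope.

HB.instance Definition _ (F : fieldType) (N : nat) :=
  Vector.copy (group_alg F N) {ffun 'S_N -> F^o}.
HB.instance Definition _ (F : fieldType) (N : nat) :=
  Algebra_isFalgebra.Build F (group_alg F N).

Lemma ga_star_conj_coef (R : realType) (N : nat) (a : group_alg R[i] N) p :
  ga_coef (ga_star (ga_conj a)) p = ((ga_coef a p^-1%g)^*)%R.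
Proof. by rewrite !ga_of_funE. Qed.

Lemma ga_star_conj_proper (R : realType) (N : nat) :
  proper_star (fun a : group_alg R[i] N => ga_star (ga_conj a)).
Proof.
split.
- by move=> a; apply/gaP => p; rewrite !ga_star_conj_coef invgK conjCK.
- move=> a b; apply/gaP => p; rewrite ga_star_conj_coef !ga_coefM rmorph_sum.
  (* [a] at [q] pairs with [b] at [p^-1 * q^-1], the inverse of [q * p], which
     is where the adjoint of [b] is evaluated *)
  rewrite [RHS](reindex_inj (mulIg p)) /=; apply: eq_bigr => q _.
  by rewrite !ga_star_conj_coef rmorphM mulrC (invMg q p) mulKVg invgK.
- by move=> k a; apply/gaP => p; rewrite ga_star_conj_coef !ga_coefZ
     ga_star_conj_coef rmorphM.
- move=> a /gaP/(_ 1%g); rewrite ga_coefM ga_coef0.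
  under eq_bigr do rewrite mul1g ga_star_conj_coef invgK -normCK.
  move/eqP; rewrite psumr_eq0 => [/allP a0|p _]; last exact: exprn_ge0.
  apply/gaP => p; rewrite ga_coef0; apply/eqP.
  by have := a0 p (mem_index_enum _); rewrite sqrf_eq0 normr_eq0.
Qed.

Theorem theorem2p8 (R : realType) (N K : nat) (hN : (1 <= N)%N) (hK : (1 <= K)%N)
    (I : set (group_alg R[i] N)) (hmin : minimal_right_ideal I)
    (hJ0 : ~ (I `<=` J0 R[i] N K)) :
  (forall e : group_alg R[i] N,
     generating_idempotents I e -> primitive_idempotent e) /\
  exists f : group_alg R[i] N,
    [/\ generating_idempotents I f,
        ga_star (ga_conj f) = f,
        forall g : group_alg R[i] N,
          generating_idempotents I g -> ga_star (ga_conj g) = g -> g = f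
      & forall e : group_alg R[i] N, generating_idempotents I e ->
          exists mu : R, f = mu%:C *: (e * ga_star (ga_conj e))].
Proof.
split=> [e genIe|]; first exact: generating_idempotent_primitive genIe hmin.
have starP := ga_star_conj_proper R N.
have uniq := selfadjoint_generating_idempotent_unique starP.
have [e genIe] := proper_star_has_idempotent starP hmin.
have [mu [_ genf sf]] := proper_star_selfadjoint starP hmin genIe.
exists (mu *: (e * ga_star (ga_conj e))); split=> // [g geng sg|g geng].
  exact: uniq geng sg genf sf.
have [nu [nuR genfg sfg]] := proper_star_selfadjoint starP hmin geng.
exists (complex.Re nu); rewrite (uniq _ _ _ genf sf genfg sfg).
by congr (_ *: _); rewrite RRe_real.
Qed.
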